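(* Every Hamiltonian graph is resistance positive, but the converse is not always true: there exists a resistance positive graph that is not Hamiltonian.
   Context: All graphs $G=(V,E)$ are finite, simple (no multi-edges), loopless and connected. A graph $G$ is Hamiltonian if it contains a cycle graph of length $|V(G)|$ as a subgraph. A spanning tree of $G$ is a maximal acyclic subset of edges $T\subseteq E$. For edge weights $c=(c_e)_{e\in E}$ with $0<c_e<\infty$, the relative resistance of $e\in E$ is $r_e(c)=\frac{\sum_{T\ni e}\prod_{t\in T}c_t}{\sum_{T}\prod_{t\in T}c_t}$, with sums over spanning trees $T$, and the resistance curvature of $v\in V$ is $p_v(c)=1-\frac12\sum_{uv\in E}r_{uv}(c)$ (sum over edges incident to $v$). $G$ is resistance positive (RP) if there exist weights $c$ with $p_v(c)>0$ for all $v\in V$. *)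

(* Defs.v *)
From mathcomp Require Import all_boot all_order all_algebra.
From mathcomp Require Import reals.

Set Implicit Arguments.
Unset Strict Implicit.
Unset Printing Implicit Defensive.

Import Order.TTheory GRing.Theory Num.Theory.
Local Open Scope ring_scope.

(* An edge is a two-element set of vertices: this rules out loops and
   multi-edges. *)
Definition adjacent (V : finType) (F : {set {set V}}) : rel V :=
  [rel u v | [set u; v] \in F].

Record graph := Graph {
  vertex :> finType;
  edges : {set {set vertex}};
  edges_card2 : forall e : {set vertex}, e \in edges -> #|e| = 2%N;
  vertex_gt0 : (0 < #|vertex|)%N;
  graph_connected : forall u v : vertex, connect (adjacent edges) u v
}.

(* The cycle graph of length [n] exists only for [n >= 3]; without this bound
   [cycle] would count an edge traversed back and forth, and [n = 0]. *)
Definition has_cycle (V : finType) (F : {set {set V}}) (n : nat) : bool :=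
  (2 < n)%N && [exists s : n.-tuple V, cycle (adjacent F) s && uniq s].

Definition hamiltonian (G : graph) : bool := has_cycle (edges G) #|G|.

(* A cycle has pairwise distinct vertices, hence length at most [#|V|]. *)
Definition acyclic (V : finType) (F : {set {set V}}) : bool :=
  [forall n : 'I_#|V|.+1, ~~ has_cycle F n].

Definition spanning_tree (G : graph) (T : {set {set G}}) : bool :=
  maxset [pred F : {set {set G}} | (F \subset edges G) && acyclic F] T.

(* Weights are functions on all sets of vertices, but only their values on
   edges matter, since spanning trees consist of edges. *)
Definition relative_resistance (R : realType) (G : graph) (c : {set G} -> R)
    (e : {set G}) : R :=
  (\sum_(T : {set {set G}} | spanning_tree T && (e \in T)) \prod_(t in T) c t)
  / (\sum_(T : {set {set G}} | spanning_tree T) \prod_(t in T) c t).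

Definition resistance_curvature (R : realType) (G : graph) (c : {set G} -> R)
    (v : G) : R :=
  1 - 2^-1 * \sum_(e in edges G | v \in e) relative_resistance c e.

Definition resistance_positive (R : realType) (G : graph) : Prop :=
  exists c : {set G} -> R,
    (forall e : {set G}, e \in edges G -> 0 < c e) /\
    (forall v : G, 0 < resistance_curvature c v).

(* Main.v *)
(** A spanning tree [T] contributes [w T * (2 - degree T v)] to twice the
    curvature at [v], up to division by the total weight of the spanning
    trees. On a Hamiltonian graph, concentrate the weights on a Hamiltonian
    cycle: in the limit only the trees inside the cycle matter, and for them
    this contribution is nonnegative and not always zero. A vertex-transitive graph
    has constant curvature under unit weights, and the curvatures sum up to
    [1]; so the Petersen graph, which is not Hamiltonian, is resistance
    positive. *)
Require Import Defs.
From mathcomp Require Import all_boot all_order all_algebra.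
From mathcomp Require Import reals.
From mathcomp Require Import zify lra.

Set Implicit Arguments.
Unset Strict Implicit.
Unset Printing Implicit Defensive.

Import Order.TTheory GRing.Theory Num.Theory.

(** * Forests, and the edge sets of paths and cycles *)

Section Forests.
Variable V : finType.
Implicit Types (F H : {set {set V}}) (u v w x : V) (p s : seq V).

Lemma adjacentE F u v : adjacent F u v = ([set u; v] \in F).
Proof. by []. Qed.

Lemma adjacent_sym F : symmetric (adjacent F).
Proof. by move=> u v; rewrite !adjacentE setUC. Qed.

Lemma connect_adjacent_sym F : connect_sym (adjacent F).
Proof. exact/sym_connect_sym/adjacent_sym. Qed.

Lemma sub_connect_adjacent F H : F \subset H ->
  subrel (connect (adjacent F)) (connect (adjacent H)).
Proof.
by move=> sFH; apply: connect_sub => u v uv; apply/connect1/(subsetP sFH).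
Qed.

Lemma has_cycleP F n :
  reflect (exists s, [/\ 2 < size s, size s = n, cycle (adjacent F) s & uniq s])
          (has_cycle F n).
Proof.
apply: (iffP andP) => [[n2 /existsP[s /andP[sc su]]]|[s [s2 <- sc su]]].
  by exists s; rewrite size_tuple.
by split=> //; apply/existsP; exists (in_tuple s); rewrite sc.
Qed.

Lemma acyclicP F :
  reflect (forall s, 2 < size s -> cycle (adjacent F) s -> uniq s -> False)
          (acyclic F).
Proof.
apply: (iffP forallP) => [acF s s2 sc su|acF n]; last first.
  by apply/has_cycleP => -[s [s2 _ sc su]]; exact: (acF s).
have sV : size s < #|V|.+1 by rewrite ltnS -(card_uniqP su) max_card.
by have /has_cycleP[] := acF (Ordinal sV); exists s.
Qed.

Lemma sub_acyclic F H : F \subset H -> acyclic H -> acyclic F.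
Proof.
move=> sFH /acyclicP acH; apply/acyclicP => s s2 sc; apply: acH => //.
by apply: sub_cycle sc => u v; apply: (subsetP sFH).
Qed.

Lemma acyclic_set0 : acyclic (set0 : {set {set V}}).
Proof. by apply/acyclicP => -[|x [|y s]] //= _; rewrite adjacentE inE. Qed.

(** A connection from [u] to [v] within [F], shortened to repeat no vertex, closes up with
    [[set u; v]]; since this edge is not in [F], the resulting cycle has length at least 3. *)
Lemma acyclic_edge_disconnects F u v : u != v -> [set u; v] \notin F ->
  acyclic ([set u; v] |: F) -> ~~ connect (adjacent F) u v.
Proof.
move=> nuv uvF /acyclicP acF; apply/connectP => -[p0 pp0 ev].
case: (shortenP pp0) ev => p pp up _ ev.
apply: (acF (u :: p)) => //.
  case: p pp ev {up} => [|x [|y p]] //=; first by move=> _ ev; rewrite ev eqxx in nuv.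
  by rewrite adjacentE andbT => xF ev; rewrite ev xF in uvF.
rewrite /= rcons_path -ev adjacent_sym adjacentE setU11 andbT.
by apply: sub_path pp => x y; apply: setU1r.
Qed.

(* Adding the edges one by one, each of them joins two components, so a set
   meeting every component can drop one point. *)
Lemma acyclic_meets_components F : {in F, forall e : {set V}, #|e| = 2} ->
  acyclic F -> exists S : {set V}, #|S| + #|F| <= #|V| /\
    forall x, exists2 y, y \in S & connect (adjacent F) x y.
Proof.
move cF: #|F| => n; elim: n F cF => [|n IHn] F cF F2 acF.
  exists setT; rewrite cardsT addn0; split=> // x.
  by exists x; rewrite ?inE.
have [e eF] : exists e, e \in F by apply/card_gt0P; rewrite cF.
have /eqP/cards2P[u [v [nuv ee]]] := F2 e eF; rewrite {}ee in eF.
have sF0F : F :\ [set u; v] \subset F by apply: subD1set.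
have cF' : #|F :\ [set u; v]| = n.
  by move: cF; rewrite (cardsD1 [set u; v]) eF => -[].
have [S [cS domS]] : exists S : {set V}, #|S| + #|F :\ [set u; v]| <= #|V| /\
    forall x, exists2 y, y \in S & connect (adjacent (F :\ [set u; v])) x y.
  rewrite cF'; apply: IHn => //; last exact: sub_acyclic acF.
  by move=> f /(subsetP sF0F); apply: F2.
have nc : ~~ connect (adjacent (F :\ [set u; v])) u v.
  by apply: acyclic_edge_disconnects; rewrite ?setD11 // setD1K.
have [s sS us] := domS u; have [t tS vt] := domS v.
have nst : s != t.
  apply: contra nc => /eqP est; apply: connect_trans us _.
  by rewrite connect_adjacent_sym est.
(* Points represented by [t] pass to [s], going through [v] and the restored edge to [u]. *)
exists (S :\ t); split.
  by move: cS; rewrite cF'; rewrite (cardsD1 t S) tS; lia.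
move=> x; have [y yS xy] := domS x; have [eyt|nyt] := eqVneq y t; last first.
  by exists y; [rewrite !inE nyt | apply: sub_connect_adjacent xy].
exists s; first by rewrite !inE nst.
apply: connect_trans (sub_connect_adjacent sF0F xy) _.
rewrite eyt; apply: (@connect_trans _ _ v).
  by rewrite connect_adjacent_sym; apply: sub_connect_adjacent vt.
apply: (@connect_trans _ _ u); last exact: sub_connect_adjacent us.
by apply: connect1; rewrite adjacentE setUC.
Qed.

Lemma acyclic_card F : 0 < #|V| -> {in F, forall e : {set V}, #|e| = 2} ->
  acyclic F -> #|F| < #|V|.
Proof.
move=> /card_gt0P[x _] F2 acF.
have [S [cS domS]] := acyclic_meets_components F2 acF.
have [y yS _] := domS x.
by have : 0 < #|S| by [apply/card_gt0P; exists y]; lia.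
Qed.

Definition degree F v : nat := \sum_(e in F) (v \in e : nat).

Lemma degree_setU1 F (e : {set V}) v :
  degree (e |: F) v <= (v \in e) + degree F v.
Proof.
rewrite /degree; have [eF|eF] := boolP (e \in F); last by rewrite big_setU1.
by rewrite (setUidPr _) ?sub1set // leq_addl.
Qed.

Lemma sub_degree F H v : F \subset H -> degree F v <= degree H v.
Proof. by move=> sFH; rewrite /degree [leqRHS](big_setID F) (setIidPr sFH) leq_addr. Qed.

Lemma degree_le_card F v : degree F v <= #|F|.
Proof. by rewrite -sum1_card; apply: leq_sum => e _; case: (v \in e). Qed.

Lemma handshake F : {in F, forall e : {set V}, #|e| = 2} ->
  \sum_v degree F v = #|F| * 2.
Proof.
move=> F2; rewrite exchange_big /= -sum_nat_const; apply: eq_bigr => e eF.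
by rewrite -(F2 e eF) -sum1_card [RHS]big_mkcond; apply: eq_bigr => v _; case: (v \in e).
Qed.

Fixpoint path_edges v p : {set {set V}} :=
  if p is w :: p' then [set v; w] |: path_edges w p' else set0.

Lemma path_edges_sub F v p : path (adjacent F) v p -> path_edges v p \subset F.
Proof.
elim: p v => [|w p IHp] v /=; first by rewrite sub0set.
by case/andP=> vw wp; rewrite subUset sub1set -adjacentE vw IHp.
Qed.

Lemma path_edges_rcons v p w :
  path_edges v (rcons p w) = [set last v p; w] |: path_edges v p.
Proof. by elim: p v => //= x p IHp v; rewrite IHp setUCA. Qed.

Lemma mem_path_edges v p (e : {set V}) x :
  e \in path_edges v p -> x \in e -> x \in v :: p.
Proof.
elim: p v => [|w p IHp] v /=; first by rewrite inE.
case/setU1P=> [->|ep xe]; first by rewrite !inE => /orP[]->; rewrite ?orbT.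
by rewrite in_cons IHp ?orbT.
Qed.

Lemma card_path_edges v p : uniq (v :: p) -> #|path_edges v p| = size p.
Proof.
elim: p v => [|w p IHp] v; first by rewrite cards0.
rewrite cons_uniq => /andP[nv up]; rewrite /= cardsU1 IHp //.
suff -> : [set v; w] \notin path_edges w p by [].
by apply: contra nv => /mem_path_edges; apply; rewrite set21.
Qed.

(** A cycle through [v] has two distinct neighbours of [v] on it, but [w] is the only candidate. *)
Lemma acyclic_add_leaf F v w :
  (forall e : {set V}, e \in F -> v \notin e) ->
  acyclic F -> acyclic ([set v; w] |: F).
Proof.
move=> nvF /acyclicP acF; apply/acyclicP => s s2 sc su.
have nb x : adjacent ([set v; w] |: F) v x -> x \in [set v; w].
  case/setU1P => [<-|/nvF]; first by rewrite set22.
  by rewrite set21.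
have [vs|nvs] := boolP (v \in s); last first.
  apply: (acF s) => //.
  apply: (@sub_in_cycle _ (mem s) _ _ _ s (allss s) sc) => x y xs ys.
  case/setU1P => // exy; have : v \in [set x; y] by rewrite exy set21.
  by case/set2P => e; rewrite e ?xs ?ys in nvs.
have [i s' es] := rot_to vs.
have : cycle (adjacent ([set v; w] |: F)) (v :: s') by rewrite -es rot_cycle.
have : uniq (v :: s') by rewrite -es rot_uniq.
have : 2 < size (v :: s') by rewrite -es size_rot.
case: s' {es} => [|a s'] //; case/lastP: s' => [|q z] // _.
rewrite !cons_uniq [cycle _ _]/= rcons_path last_rcons !(inE, mem_rcons, negb_or).
move=> /and3P[/and3P[va vz _] /andP[az _] _] /and3P[/nb + _].
rewrite adjacent_sym => + /nb.
rewrite !inE ![_ == v]eq_sym (negPf va) (negPf vz) /= => /eqP ea /eqP ez.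
by rewrite ea ez eqxx in az.
Qed.

Lemma acyclic_path_edges v p : uniq (v :: p) -> acyclic (path_edges v p).
Proof.
elim: p v => [|w p IHp] v; first by rewrite acyclic_set0.
rewrite cons_uniq => /andP[nv up]; apply: acyclic_add_leaf; last exact: IHp.
by move=> e /mem_path_edges ep; apply: contra nv => /ep.
Qed.

(** The indicator terms record the room left at each endpoint: closing the path into a cycle uses up
    both, and the start of the path has degree at most 1. *)
Lemma degree_path_edges v p x : uniq (v :: p) ->
  degree (path_edges v p) x + (x == v) + (x == last v p) <= 2.
Proof.
elim: p v => [|w p IHp] v.
  by rewrite /degree /= big_set0; case: (x == v).
rewrite cons_uniq => /andP[nv up] /=; have := IHp w up.
have := degree_setU1 (path_edges w p) [set v; w] x; rewrite !inE.
have [->|_ /=] := eqVneq x v; last by case: (x == w); lia.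
have -> : (v == last w p) = false.
  by apply/eqP => e; rewrite e mem_last in nv.
suff -> : degree (path_edges w p) v = 0 by rewrite /=; lia.
rewrite /degree big1 // => e ep; case: (boolP (v \in e)) => //.
by move/(mem_path_edges ep); rewrite (negPf nv).
Qed.

Definition cycle_edges s := if s is x :: p then path_edges x (rcons p x) else set0.

(** This lets a cycle be cut open at any chosen vertex. *)
Lemma cycle_edges_rot n s : cycle_edges (rot n s) = cycle_edges s.
Proof.
have rot1E q : cycle_edges (rot 1 q) = cycle_edges q.
  case: q => [|x [|y q]] //; rewrite rot1_cons /= path_edges_rcons.
  by rewrite last_rcons.
elim: n => [|n IHn]; first by rewrite rot0.
have [ns|sn] := ltnP n (size s); first by rewrite rotS // rot1E.
by rewrite rot_oversize // ltnW.
Qed.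

Lemma degree_cycle_edges s x : uniq s -> degree (cycle_edges s) x <= 2.
Proof.
case: s => [|v p] us; first by rewrite /degree big_set0.
rewrite /= path_edges_rcons; apply: leq_trans (degree_setU1 _ _ _) _.
have := degree_path_edges x us; rewrite !inE.
by case: (x == v); case: (x == last v p); rewrite /=; lia.
Qed.

End Forests.

(** * Spanning trees, and curvature as a sum over them *)

Section SpanningTrees.
Variable G : graph.
Implicit Types (F T : {set {set G}}) (v : G).

Lemma spanning_treeP T :
  reflect ([/\ T \subset edges G, acyclic T &
            forall F, F \subset edges G -> acyclic F -> T \subset F -> F = T])
          (spanning_tree T).
Proof.
apply: (iffP maxsetP) => /=.
  case=> /andP[sT acT] mT; split=> // F sF acF sTF; apply: mT => //.
  by rewrite sF.
case=> sT acT mT; split; first by rewrite sT.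
by move=> F /andP[sF acF]; apply: mT.
Qed.

Lemma sub_edges_card2 F : F \subset edges G ->
  {in F, forall e : {set G}, #|e| = 2}.
Proof. by move=> /subsetP sF e /sF; apply: edges_card2. Qed.

Lemma spanning_tree_card T : spanning_tree T -> #|T| < #|G|.
Proof.
case/spanning_treeP => sT acT _; apply: acyclic_card (vertex_gt0 G) _ acT.
exact: sub_edges_card2.
Qed.

(** A strictly larger acyclic set would exceed the bound of [acyclic_card]. *)
Lemma spanning_tree_of_card T : T \subset edges G -> acyclic T ->
  #|T|.+1 = #|G| -> spanning_tree T.
Proof.
move=> sT acT cT; apply/spanning_treeP; split=> // F sF acF sTF.
apply/esym/eqP; rewrite eqEcard sTF -ltnS cT.
exact: acyclic_card (vertex_gt0 G) (sub_edges_card2 sF) acF.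
Qed.

Lemma spanning_tree_exists : exists T, spanning_tree T.
Proof.
have [|T sT _] := @maxset_exists _
    [pred F : {set {set G}} | (F \subset edges G) && acyclic F] set0.
  by rewrite /= sub0set acyclic_set0.
by exists T.
Qed.

Local Open Scope ring_scope.
Variables (R : realType) (c : {set G} -> R).

Definition tree_weight T : R := \prod_(t in T) c t.

Hypothesis c_gt0 : forall e, e \in edges G -> 0 < c e.

Lemma tree_weight_gt0 T : T \subset edges G -> 0 < tree_weight T.
Proof. by move=> /subsetP sT; apply: prodr_gt0 => e /sT; apply: c_gt0. Qed.

(** Exchanging the sums over edges at [v] and over trees counts each [T] once per edge of [T] at
    [v]. So the given sum is twice the curvature times the total tree weight [Z]. *)
Lemma resistance_curvature_gt0 v :
  0 < \sum_(T | spanning_tree T) tree_weight T * (2 - (degree T v)%:R) ->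
  0 < resistance_curvature c v.
Proof.
set Z := \sum_(T : {set {set G}} | spanning_tree T) tree_weight T.
have Z_gt0 : 0 < Z.
  have [T0 stT0] := spanning_tree_exists.
  rewrite /Z (bigD1 T0) //= ltr_pwDl //.
    by apply: tree_weight_gt0; case/spanning_treeP: stT0.
  apply: sumr_ge0 => T /andP[/spanning_treeP[sT _ _] _].
  exact/ltW/tree_weight_gt0.
have -> : \sum_(T | spanning_tree T) tree_weight T * (2 - (degree T v)%:R) =
    2 * Z - \sum_(T | spanning_tree T) tree_weight T * (degree T v)%:R.
  rewrite /Z mulr_sumr -sumrB; apply: eq_bigr => T _.
  by rewrite mulrBr [_ * 2]mulrC.
have -> : \sum_(T | spanning_tree T) tree_weight T * (degree T v)%:R =
    (\sum_(e in edges G | v \in e) relative_resistance c e) * Z.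
  rewrite mulr_suml.
  under [RHS]eq_bigr => e _ do rewrite /relative_resistance divfK ?gt_eqF //.
  under [RHS]eq_bigr => e _ do rewrite big_mkcondr.
  rewrite exchange_big; apply: eq_bigr => T /spanning_treeP[sT _ _] /=.
  rewrite /degree natr_sum mulr_sumr -big_mkcondr /=.
  rewrite [LHS](bigID (fun e : {set G} => v \in e)) /= addrC big1 ?add0r; last first.
    by move=> e /andP[_ /negPf->]; rewrite mulr0.
  apply: eq_big => [e|e /andP[_ ->]]; last by rewrite mulr1.
  rewrite -andbA [(v \in e) && _]andbC andbA; congr (_ && _).
  by have [/(subsetP sT)->|] := boolP (e \in T); rewrite ?andbT ?andbF.
rewrite /resistance_curvature -mulrBl pmulr_lgt0 // => pos.
by rewrite -(pmulr_rgt0 _ (ltr0Sn R 1)) mulrBr mulrA divff ?pnatr_eq0 // mul1r mulr1.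
Qed.

End SpanningTrees.

(** * Hamiltonian graphs *)

Lemma prod_le_factor (R : realDomainType) (I : finType) (A : {set I})
    (f : I -> R) (i : I) :
  i \in A -> (forall j, 0 <= f j <= 1)%R -> (\prod_(j in A) f j <= f i)%R.
Proof.
move=> iA f01; have /andP[fi _] := f01 i; rewrite (bigD1 i) //= ler_piMr //.
by rewrite prodr_ile1.
Qed.

(* With weight [1] on the Hamiltonian cycle and a small weight [x] elsewhere,
   the trees inside the cycle have degrees at most [2], one of them has degree
   at most [1] at [v], and the other trees contribute [O(x)]. *)
Lemma hamiltonian_resistance_positive (R : realType) (G : graph) :
  hamiltonian G -> resistance_positive R G.
Proof.
case/has_cycleP => s [s2 ss sc su].
pose H := cycle_edges s.
(* [K] bounds the sum of [#|T|] over the spanning trees, so the total error, at most [x * K], stays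
   below the 1 gained from a single tree. *)
pose K := \sum_(T : {set {set G}}) #|T|.
pose x : R := (K.+1%:R^-1)%R.
have x_gt0 : (0 < x)%R by rewrite invr_gt0 ltr0Sn.
have x_le1 : (x <= 1)%R by rewrite invf_le1 ?ltr0Sn // ler1n.
pose c (e : {set G}) : R := if e \in H then 1%R else x.
have c_gt0 e : (0 < c e)%R by rewrite /c; case: ifP.
have c_01 e : (0 <= c e <= 1)%R by rewrite ltW //= /c; case: ifP.
exists c; split=> // v; apply: resistance_curvature_gt0 => //.
have [i p es] : rot_to_spec s v.
  apply: rot_to; suff /(_ v): s =i G by rewrite !inE.
  by apply/subset_cardP; [rewrite (card_uniqP su) | apply/subsetP].
have uvp : uniq (v :: p) by rewrite -es rot_uniq.
(* The Hamiltonian cycle with one of its two edges at [v] removed. *)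
pose T0 := path_edges v p.
have sT0 : T0 \subset edges G.
  apply: path_edges_sub.
  by move: sc; rewrite -(rot_cycle i) es /= rcons_path => /andP[].
have sT0H : T0 \subset H.
  by rewrite /H -(cycle_edges_rot i) es /= path_edges_rcons subsetU1.
have stT0 : spanning_tree T0.
  apply: spanning_tree_of_card; rewrite ?acyclic_path_edges //.
  by rewrite card_path_edges // -ss -(size_rot i s) es.
have dT0 : degree T0 v <= 1.
  by have := degree_path_edges v uvp; rewrite eqxx -/T0; lia.
have wH (T : {set {set G}}) : T \subset H -> tree_weight c T = 1%R.
  by move=> /subsetP sT; apply: big1 => e /sT eH; rewrite /c eH.
(* One bound for all trees, ready for summation: [T0] yields at least 1, other trees inside [H] at
   least 0, and a tree leaving [H] has weight at most [x]. *)
have bound (T : {set {set G}}) : spanning_tree T ->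
    ((T == T0)%:R - x * #|T|%:R <= tree_weight c T * (2 - (degree T v)%:R))%R.
  move=> _; have dT : ((degree T v)%:R <= #|T|%:R :> R)%R.
    by rewrite ler_nat degree_le_card.
  have xT : (0 <= x * #|T|%:R)%R by rewrite mulr_ge0 // ltW.
  have [sTH|] := boolP (T \subset H).
    rewrite wH // mul1r; have [->|_] := eqVneq T T0.
      have : ((degree T0 v)%:R <= 1 :> R)%R by rewrite lern1.
      have : (0 <= x * #|T0|%:R)%R by rewrite mulr_ge0 // ltW.
      rewrite [true%:R%R]mulr1n; lra.
    have : ((degree T v)%:R <= 2 :> R)%R.
      rewrite ler_nat; apply: leq_trans (sub_degree v sTH) _.
      exact: degree_cycle_edges.
    by rewrite mulr0n; lra.
  have [-> /negP //|_ /subsetPn[e eT eH]] := eqVneq T T0.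
  have wx : (tree_weight c T <= x)%R.
    by apply: le_trans (prod_le_factor eT c_01) _; rewrite /c (negPf eH).
  have w0 : (0 <= tree_weight c T)%R by apply: prodr_ge0 => f _; apply: ltW.
  have : (tree_weight c T * (degree T v)%:R <= x * #|T|%:R)%R.
    by rewrite ler_pM.
  by rewrite mulr0n mulrBr; lra.
apply: lt_le_trans (ler_sum _ bound).
rewrite sumrB -mulr_sumr (bigD1 T0) //= eqxx big1 => [|T /andP[_ /negPf->]] //.
rewrite addr0 subr_gt0 -natr_sum.
have : (\sum_(T : {set {set G}} | spanning_tree T) #|T| < K.+1).
  by rewrite ltnS /K [leqRHS](bigID (@spanning_tree G)) leq_addr.
by rewrite -(ltr_nat R) /x mulrC ltr_pdivrMr ?ltr0Sn // mul1r.
Qed.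

(** * Automorphisms and vertex-transitive graphs *)

Section Automorphisms.
Variables (G : graph) (f : G -> G).
Hypothesis f_inj : injective f.
Hypothesis f_edge : forall e, e \in edges G -> f @: e \in edges G.

Definition edge_image (F : {set {set G}}) : {set {set G}} :=
  [set f @: e | e : {set G} in F].

Lemma edge_image_inj : injective edge_image.
Proof. exact/imset_inj/imset_inj. Qed.

Lemma edge_imageS F1 F2 : (edge_image F1 \subset edge_image F2) = (F1 \subset F2).
Proof.
apply/idP/idP => [/subsetP s12|]; last exact: imsetS.
apply/subsetP => e eF; have := s12 (f @: e); rewrite !(mem_imset _ _ (imset_inj f_inj)).
exact.
Qed.

Lemma edge_image_surj F : exists F', F = edge_image F'.
Proof. by exists (invF edge_image_inj F); rewrite f_invF. Qed.

(** The edge set is finite, so an injective map from it to itself is onto. *)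
Lemma edge_image_edges : edge_image (edges G) = edges G.
Proof.
apply/eqP; rewrite eqEcard card_imset ?leqnn ?andbT; last exact: imset_inj.
by apply/subsetP => _ /imsetP[e eE ->]; apply: f_edge.
Qed.

Lemma edge_image_adjacent F u v :
  adjacent (edge_image F) (f u) (f v) = adjacent F u v.
Proof.
rewrite !adjacentE -(mem_imset _ [set u; v] (imset_inj f_inj)).
by rewrite imsetU1 imset_set1.
Qed.

Lemma edge_image_cycle F s :
  cycle (adjacent (edge_image F)) (map f s) = cycle (adjacent F) s.
Proof.
rewrite cycle_map; apply: eq_cycle => u v /=; exact: edge_image_adjacent.
Qed.

Lemma edge_image_acyclic F : acyclic (edge_image F) = acyclic F.
Proof.
apply/acyclicP/acyclicP => acF s s2 sc su.
  by apply: (acF (map f s)); rewrite ?size_map ?edge_image_cycle ?map_inj_uniq.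
have es : s = map f (map (invF f_inj) s).
  by rewrite -map_comp map_id_in // => x _ /=; rewrite f_invF.
rewrite es edge_image_cycle in sc.
by apply: (acF _ _ sc); rewrite ?size_map // -(map_inj_uniq f_inj) -es.
Qed.

Lemma edge_image_spanning_tree T :
  spanning_tree (edge_image T) = spanning_tree T.
Proof.
have imE F : (edge_image F \subset edges G) = (F \subset edges G).
  by rewrite -{1}edge_image_edges edge_imageS.
apply/spanning_treeP/spanning_treeP; rewrite imE edge_image_acyclic => -[sT acT mT].
  split=> // F sF acF sTF; apply: edge_image_inj; apply: mT.
  - by rewrite imE.
  - by rewrite edge_image_acyclic.
  - by rewrite edge_imageS.
(* Any competitor for maximality is itself an image, hence can be pulled back along [f]. *)
split=> // F; have [{}F ->] := edge_image_surj F.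
by rewrite imE edge_imageS edge_image_acyclic => sF acF sTF; rewrite (mT F).
Qed.

Lemma edge_image_degree F v : degree (edge_image F) (f v) = degree F v.
Proof.
rewrite /degree big_imset /=; last by move=> ? ? _ _; apply: imset_inj.
by apply: eq_bigr => e _; rewrite mem_imset.
Qed.

End Automorphisms.

(* With unit weights all vertices have the same curvature, and the curvatures
   sum up to [#|G| - (#|G| - 1) > 0] because spanning trees have [#|G| - 1] edges. *)
Lemma vertex_transitive_resistance_positive (R : realType) (G : graph) (u0 : G) :
  (forall v : G, exists f : G -> G,
     [/\ injective f, forall e, e \in edges G -> f @: e \in edges G & f u0 = v]) ->
  resistance_positive R G.
Proof.
move=> transG; exists (fun=> 1%R); split=> [e _|v]; first exact: ltr01.
apply: resistance_curvature_gt0 => [e _|]; first exact: ltr01.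
pose D u : R := (\sum_(T : {set {set G}} | spanning_tree T) (2 - (degree T u)%:R))%R.
have -> : (\sum_(T : {set {set G}} | spanning_tree T)
    tree_weight (fun=> 1) T * (2 - (degree T v)%:R) = D v :> R)%R.
  by apply: eq_bigr => T _; rewrite /tree_weight big1 ?mul1r.
have D0 u : D u0 = D u.
  have [f [f_inj f_edge <-]] := transG u.
  (* Reindexing the trees by their images turns degrees at [f u0] into degrees at [u0]. *)
  rewrite [RHS]/D (reindex_inj (edge_image_inj f_inj)).
  apply: eq_big => [T|T _]; first by rewrite edge_image_spanning_tree.
  by rewrite edge_image_degree.
(* Multiplying by [#|G|] turns the value at [v] into the sum over all vertices, to which [handshake]
   applies tree by tree. *)
rewrite -(@pmulr_lgt0 _ #|G|%:R); last by rewrite ltr0n vertex_gt0.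
have -> : (D v * #|G|%:R = \sum_u D u)%R.
  by rewrite -D0 -(eq_bigr _ (fun u _ => D0 u)) sumr_const mulr_natr.
rewrite exchange_big /=.
have sumE (T : {set {set G}}) : spanning_tree T ->
    (0 < \sum_(u : G) (2 - (degree T u)%:R) :> R)%R.
  move=> stT; rewrite sumrB sumr_const -natr_sum handshake; last first.
    by apply: sub_edges_card2; case/spanning_treeP: stT.
  by rewrite -mulrnA subr_gt0 ltr_nat mulnC ltn_pmul2l // spanning_tree_card.
have [T0 stT0] := spanning_tree_exists G.
rewrite (bigD1 T0) //= ltr_pwDl ?sumE //.
by apply: sumr_ge0 => T /andP[stT _]; apply/ltW/sumE.
Qed.

(** * A resistance positive graph that is not Hamiltonian *)

(* The Petersen graph: an outer pentagon [0..4], an inner pentagram [5..9] and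
   the spokes [i, i + 5]. *)
Definition petersen_arc (x y : nat) : bool :=
  [|| (x < 5) && (y == x.+1 %% 5), (x < 5) && (y == x + 5)
    | (4 < x) && (y == 5 + x.+2 %% 5)].

Definition petersen_adj (x y : nat) : bool := petersen_arc x y || petersen_arc y x.

Definition petersen_edges : {set {set 'I_10}} :=
  [set [set p.1; p.2] | p : 'I_10 * 'I_10 & petersen_adj p.1 p.2].

Lemma petersen_adj_sym : symmetric petersen_adj.
Proof. by move=> x y; rewrite /petersen_adj orbC. Qed.

(** Finite checks on the Petersen graph pass through this form, which [vm_compute] evaluates. *)
Lemma forall_ord_iota n (P : pred nat) : all P (iota 0 n) -> forall i : 'I_n, P i.
Proof. by move=> /allP allP i; apply: allP; rewrite mem_iota ltn_ord. Qed.

Lemma petersen_adj_irrefl (x : 'I_10) : ~~ petersen_adj x x.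
Proof. exact: (@forall_ord_iota 10 (fun x => ~~ petersen_adj x x)). Qed.

Lemma set2_eq (T : finType) (a b u v : T) :
  [set a; b] = [set u; v] -> a = u /\ b = v \/ a = v /\ b = u.
Proof.
move=> e; have := set21 a b; have := set22 a b; rewrite {1 2}e.
have := set21 u v; have := set22 u v; rewrite -{1 2}e !inE.
by case/orP=> /eqP ? /orP[]/eqP ? /orP[]/eqP ? /orP[]/eqP ?; subst; auto.
Qed.

Lemma petersen_edgesE (u v : 'I_10) :
  ([set u; v] \in petersen_edges) = petersen_adj u v.
Proof.
apply/imsetP/idP => [[[a b]]|uv]; last by exists (u, v); rewrite ?inE.
rewrite inE /= => ab /set2_eq[][-> ->] //.
by rewrite petersen_adj_sym.
Qed.

Lemma petersen_edges_card2 (e : {set 'I_10}) : e \in petersen_edges -> #|e| = 2.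
Proof.
case/imsetP => -[a b]; rewrite inE /= => ab ->; rewrite cards2.
by case: eqVneq ab => // ->; rewrite (negPf (petersen_adj_irrefl b)).
Qed.

Lemma petersen_card_gt0 : 0 < #|'I_10|.
Proof. by rewrite card_ord. Qed.

(** Serves connectedness: bounding the walks by two edges makes it a finite check. *)
Lemma petersen_diameter2 (u v : 'I_10) :
  (u == v) || [exists w : 'I_10, petersen_adj u w && ((w == v) || petersen_adj w v)].
Proof.
pose P (x y : nat) :=
  (x == y) || has (fun w => petersen_adj x w && ((w == y) || petersen_adj w y)) (iota 0 10).
have : P u v.
  apply: (forall_ord_iota (P := P u)) v.
  by apply: (forall_ord_iota (P := fun x => all (P x) (iota 0 10))) u; vm_compute.
case/orP => [/eqP/val_inj->|/hasP[w]]; first by rewrite eqxx.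
rewrite mem_iota => w10 uwv; apply/orP; right.
by apply/existsP; exists (Ordinal w10).
Qed.

Lemma petersen_connected (u v : 'I_10) : connect (adjacent petersen_edges) u v.
Proof.
case/orP: (petersen_diameter2 u v) => [/eqP-> //|/existsP[w /andP[uw wv]]].
rewrite -petersen_edgesE in uw; apply: connect_trans (connect1 uw) _.
case/orP: wv => [/eqP -> //|]; rewrite -petersen_edgesE => wv; exact: connect1.
Qed.

Definition petersen : graph :=
  Graph petersen_edges_card2 petersen_card_gt0 petersen_connected.

(* Rotation by [v] when [v < 5]; otherwise doubling mod [5] exchanges the
   pentagon and the pentagram, composed with a rotation. *)
Definition petersen_move (v x : nat) : nat :=
  if v < 5 then (if x < 5 then (x + v) %% 5 else 5 + (x + v) %% 5)
  else (if x < 5 then 5 + (x.*2 + v) %% 5 else (x.*2 + v) %% 5).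

(** [inord] would send values from 10 on to vertex 0; [petersen_moveP] shows that none occurs. *)
Definition petersen_aut (v x : 'I_10) : 'I_10 := inord (petersen_move v x).

(** Range, base point, edges and injectivity are bundled so that one exhaustive check over all
    triples settles them. *)
Lemma petersen_moveP (v x y : 'I_10) :
  [&& petersen_move v x < 10, petersen_move v 0 == v,
      petersen_adj x y ==> petersen_adj (petersen_move v x) (petersen_move v y)
    & (petersen_move v x == petersen_move v y) ==> (val x == val y)].
Proof.
pose P (v x y : nat) :=
  [&& petersen_move v x < 10, petersen_move v 0 == v,
      petersen_adj x y ==> petersen_adj (petersen_move v x) (petersen_move v y)
    & (petersen_move v x == petersen_move v y) ==> (x == y)].
apply: (forall_ord_iota (P := P v x)).
apply: (forall_ord_iota (P := fun x => all (P v x) (iota 0 10))).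
apply: (forall_ord_iota
  (P := fun v => all (fun x => all (P v x) (iota 0 10)) (iota 0 10))).
by vm_compute.
Qed.

Lemma petersen_autE (v x : 'I_10) : petersen_aut v x = petersen_move v x :> nat.
Proof. by have /andP[xv _] := petersen_moveP v x x; rewrite inordK. Qed.

Lemma petersen_resistance_positive (R : realType) : resistance_positive R petersen.
Proof.
apply: (@vertex_transitive_resistance_positive R petersen (ord0 : 'I_10)) => v.
exists (petersen_aut v); split=> [x y exy|_ /imsetP[[x y] xy ->]|].
- have /and4P[_ _ _ /implyP inj] := petersen_moveP v x y.
  by apply/val_inj/eqP/inj; rewrite -!petersen_autE exy.
- rewrite imsetU1 imset_set1 petersen_edgesE !petersen_autE.
  have /and4P[_ _ /implyP adj _] := petersen_moveP v x y.
  by apply: adj; rewrite inE in xy.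
- have /and4P[_ /eqP e0 _ _] := petersen_moveP v ord0 ord0.
  by apply/val_inj; rewrite /= petersen_autE.
Qed.

(* Depth-first search for a path of length [k] from [x] to a neighbour of [0]
   through unvisited vertices. Filtering first matters for the evaluation by
   value in [vm_compute]: a conjunction would explore non-neighbours too. *)
Fixpoint petersen_search (k x : nat) (visited : seq nat) : bool :=
  if k is k'.+1 then
    has (fun y => petersen_search k' y (y :: visited))
        [seq y <- iota 0 10 | petersen_adj x y & y \notin visited]
  else petersen_adj x 0.

(** The path itself is one branch of the search; contrapositively, a failed search excludes such a
    path. *)
Lemma petersen_search_complete (x : nat) (p visited : seq nat) :
  all (fun y => y < 10) p -> path petersen_adj x p -> uniq p ->
  ~~ has (mem visited) p -> petersen_adj (last x p) 0 ->
  petersen_search (size p) x visited.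
Proof.
elim: p x visited => [|y p IHp] x vis // /andP[y10 p10] /andP[xy yp].
rewrite cons_uniq [has _ _]/= negb_or => /andP[nyp up] /andP[yvis pvis] pl.
apply/hasP; exists y; first by rewrite mem_filter mem_iota xy yvis.
apply: IHp => //; apply/hasPn => z zp; rewrite inE negb_or.
by rewrite (hasPn pvis) // andbT; apply: contraNneq nyp => <-.
Qed.

Lemma petersen_not_hamiltonian : ~~ hamiltonian petersen.
Proof.
apply/has_cycleP => -[s [_ ss sc su]].
(* Started at 0, the cycle leaves a path through the nine other vertices that ends at a neighbour of
   0. *)
have [i p es] : rot_to_spec s (ord0 : 'I_10).
  apply: rot_to; suff /(_ ord0) : s =i 'I_10 by rewrite !inE.
  by apply/subset_cardP; [rewrite (card_uniqP su) | apply/subsetP].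
have : uniq (ord0 :: p) by rewrite -es rot_uniq.
have : cycle (adjacent petersen_edges) (ord0 :: p) by rewrite -es rot_cycle.
have : size (ord0 :: p) = 10 by rewrite -es size_rot ss card_ord.
move=> [sp] pc /andP[n0p up].
have : cycle petersen_adj (map val (ord0 :: p)).
  by rewrite cycle_map; apply: sub_cycle pc => u v; rewrite adjacentE petersen_edgesE.
rewrite /= rcons_path => /andP[pp pl].
have : petersen_search 9 0 [:: 0].
  rewrite -sp -(size_map val p); apply: petersen_search_complete => //.
  - by apply/allP => _ /mapP[z _ ->]; exact: ltn_ord (z : 'I_10).
  - by rewrite (map_inj_uniq val_inj).
  - apply/hasPn => _ /mapP[z zp ->]; rewrite /= inE.
    by apply: contra n0p => /eqP z0; rewrite (_ : ord0 = z) //; apply: val_inj.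
by have -> : petersen_search 9 0 [:: 0] = false by vm_compute.
Qed.

(** The bound [2 < #|G|] rules out the trivial examples on one or two vertices, which are resistance
    positive and too small to have a cycle. *)
Theorem theorem6p2 (R : realType) :
  (forall G : graph, hamiltonian G -> resistance_positive R G) /\
  (exists G : graph,
     [/\ (2 < #|G|)%N, resistance_positive R G & ~~ hamiltonian G]).
Proof.
split=> [G|]; first exact: hamiltonian_resistance_positive.
exists petersen; split; first by rewrite card_ord.
  exact: petersen_resistance_positive.
exact: petersen_not_hamiltonian.
Qed.
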